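(* Fix $t\in E$ and assume condition (A) at $t$ (see context). Let $c\in[1,\infty)$ and let $(\alpha_{m_t})\subset(0,1)$ be a sequence such that, as $n\to\infty$, $\alpha_{m_t}\to0$, $m_t\alpha_{m_t}\to c$ and $\lfloor m_t\alpha_{m_t}\rfloor\to\lfloor c\rfloor$. If $$\omega_n\big(m_t^{-(1+\delta)}\big)\to0\quad\text{for some }\delta>0,$$ then, as $n\to\infty$, $$\frac{\hat q_1(\alpha_{m_t},t)}{q(\alpha_{m_t},t)}-1\xrightarrow{d}\mathcal E(c,\gamma(t)),$$ where $\hat q_1(\alpha_{m_t},t)=Z_{m_t-\lfloor m_t\alpha_{m_t}\rfloor+1,m_t}(t)$, $\xrightarrow{d}$ denotes convergence in distribution, and $\mathcal E(c,\gamma(t))$ is a non-degenerate probability distribution depending only on $c$ and $\gamma(t)$.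
   Context: Setting. $(E,d)$ is a (finite or infinite dimensional) metric space. For $x\in E$, $F(\cdot,x)$ is the conditional cumulative distribution function of a real random variable $Y$ given $x$, and $q(\alpha,x)\in(0,\infty)$ is the conditional quantile of order $1-\alpha$, defined by $F(q(\alpha,x),x)=1-\alpha$ for all $\alpha\in(0,1)$. For every $x\in E$ the distribution is heavy-tailed: there is $\gamma(x)>0$ (the conditional tail index) such that $\lim_{\alpha\to0}q(\lambda\alpha,x)/q(\alpha,x)=\lambda^{-\gamma(x)}$ for all $\lambda>0$. Data. $(Y_1,x_1),\dots,(Y_n,x_n)$ are observations with non-random design points $x_i\in E$ and independent $Y_i$, $Y_i$ having distribution function $F(\cdot,x_i)$. For $t\in E$, $B(t,r)=\{x\in E: d(x,t)\le r\}$, and $h_t=h_{n,t}$ is a positive sequence tending to $0$ as $n\to\infty$. $m_t=m_{n,t}=\sum_{i=1}^n\mathbb 1\{x_i\in B(t,h_t)\}$ is the (non-random) number of design points in $B(t,h_t)$; $Z_1(t),\dots,Z_{m_t}(t)$ are the $Y_i$'s for which $x_i\in B(t,h_t)$, with order statistics $Z_{1,m_t}(t)\le\dots\le Z_{m_t,m_t}(t)$. $\lfloor\cdot\rfloor$ is the integer part. Condition (A) (at the fixed point $t$): the function $\alpha\in(0,1)\mapsto q(\alpha,t)\in(0,\infty)$ is differentiable, and the function $\alpha\in(0,1)\mapsto\Delta(\alpha,t)=\gamma(t)+\alpha\,\frac{\partial\log q}{\partial\alpha}(\alpha,t)\in\mathbb R$ is continuous with $\lim_{\alpha\to0}\Delta(\alpha,t)=0$.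 Oscillation: for $a\in(0,1/2)$, $\omega_n(a)=\sup\{|\log(q(\alpha,x)/q(\alpha,x'))| : \alpha\in(a,1-a),\ (x,x')\in B(t,h_t)^2\}$. *)

(* Defs.v *)
From HB Require Import structures.
From mathcomp Require Import all_boot all_order all_algebra.
From mathcomp Require Import all_classical all_reals all_analysis.

Set Implicit Arguments.
Unset Strict Implicit.
Unset Printing Implicit Defensive.

Import Order.TTheory GRing.Theory Num.Theory.
Import numFieldNormedType.Exports.

Local Open Scope classical_set_scope.
Local Open Scope ring_scope.

Section ConditionalQuantiles.
Variables (R : realType) (E : metricType R).

(** Conditional distribution functions are written [F x y], in the argument
    order opposite to the mathematical [F(y, x)], so that each [F x] can be an
    element of the type [cumulativeBounded 0 1] of cumulative distribution
    functions.  In [q a x], the quantile of order [1 - a] given [x], only the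
    values at [0 < a < 1] are meaningful. *)

Definition conditional_quantile
    (F : E -> cumulativeBounded (0 : R) (1 : R)) (q : R -> E -> R) : Prop :=
  forall (x : E) (a : R), 0 < a < 1 -> 0 < q a x /\ F x (q a x) = 1 - a.

Definition heavy_tailed (q : R -> E -> R) (gamma : E -> R) : Prop :=
  forall x : E, 0 < gamma x /\
    forall lambda : R, 0 < lambda ->
      q (lambda * a) x / q a x @[a --> 0^'+] --> lambda `^ (- gamma x).

Definition Delta (q : R -> E -> R) (gamma : E -> R) (t : E) (a : R) : R :=
  gamma t + a * derive1 (fun b : R => ln (q b t)) a.

Definition condition_A (q : R -> E -> R) (gamma : E -> R) (t : E) : Prop :=
  [/\ forall a : R, 0 < a < 1 -> derivable (fun b : R => q b t) a 1,
      forall a : R, 0 < a < 1 -> {for a, continuous (Delta q gamma t)}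
    & Delta q gamma t a @[a --> 0^'+] --> (0 : R)].

(** The library's [closed_ball] is the closure of the open ball, which in a
    general metric space can be smaller than this set. *)
Definition cball (t : E) (r : R) : set E := [set x | mdist x t <= r].

(** The supremum is taken in [\bar R]: it is [+oo] when the oscillation is
    unbounded. *)
Definition oscillation (q : R -> E -> R) (t : E) (r a : R) : \bar R :=
  ereal_sup [set z : \bar R | exists (b : R) (x x' : E),
    [/\ a < b < 1 - a, cball t r x, cball t r x'
      & z = (`|ln (q b x / q b x')|)%:E]].

Definition local_count (n : nat) (x : 'I_n -> E) (t : E) (r : R) : nat :=
  (\sum_(i < n) (x i \in cball t r))%N.

Definition local_sample (n : nat) (x : 'I_n -> E) (y : 'I_n -> R)
    (t : E) (r : R) : seq R :=
  [seq y i | i <- enum 'I_n & x i \in cball t r].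

(** [order_stat k s] is the [k]-th smallest item of [s], counted from [1]; its
    value is [0] when [size s < k]. *)
Definition order_stat (k : nat) (s : seq R) : R := nth 0 (sort <=%R s) k.-1.

(** [Num.truncn] is the integer part, as [0 <= m%:R * a]. *)
Definition qhat1 (n : nat) (x : 'I_n -> E) (y : 'I_n -> R)
    (t : E) (r a : R) : R :=
  let m := local_count x t r in
  order_stat (m - Num.truncn (m%:R * a) + 1)%N (local_sample x y t r).

End ConditionalQuantiles.

Section Probability.
Variables (R : realType) (d : measure_display) (T : measurableType d).
Variable P : probability T R.

Definition mutually_independent (I : finType) (Y : I -> T -> R) : Prop :=
  forall (J : {set I}) (A : I -> set R),
    (forall i, measurable (A i)) ->
    P (\bigcap_(i in [set` J]) (Y i @^-1` A i)) =
    (\prod_(i in J) P (Y i @^-1` A i))%E.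

Definition cvg_in_distribution (X : nat -> T -> R)
    (mu : probability (measurableTypeR R) R) : Prop :=
  (forall n, measurable_fun setT (X n)) /\
  forall y : R, {for y, continuous (fun z : R => mu `]-oo, z]%classic)} ->
    P (X n @^-1` `]-oo, y]) @[n --> \oo] --> mu `]-oo, y]%classic.

End Probability.

Definition nondegenerate_law (R : realType)
    (mu : probability (measurableTypeR R) R) : Prop :=
  forall a : R, mu [set a] <> 1%E.

(* Main.v *)
Require Import Defs.
From HB Require Import structures.
From mathcomp Require Import all_boot all_order all_algebra.
From mathcomp Require Import all_classical all_reals all_analysis.
From mathcomp Require Import measurable_realfun ring lra zify.
Set Implicit Arguments.
Unset Strict Implicit.
Unset Printing Implicit Defensive.
Import Order.TTheory GRing.Theory Num.Theory.
Import numFieldNormedType.Exports.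
Local Open Scope classical_set_scope.
Local Open Scope ring_scope.

(** Let [K] be the integer part of [c] and [z = (1 + y) q(alpha, t)].  The
    estimator is the [K]-th largest of the [m] local observations, so it is at
    most [z] exactly when fewer than [K] of them exceed [z].  Since quantiles
    decrease in their order, regular variation at [t] together with the
    oscillation condition at the orders [la * alpha] (eventually larger than
    [m ^ -(1 + delta)], because [m * alpha] has a positive limit) squeezes all
    the local tail probabilities between [la1 * alpha] and [la2 * alpha], for
    any [la1 < (1 + y) ^ (-1 / gamma) < la2].  Expanding over the set of
    exceeding indices, the probability of fewer than [K] exceedances is then
    squeezed between two binomial-like sums, and the law of rare events gives
    the limit [P(N < K)], with [N] a Poisson variable of mean
    [c (1 + y) ^ (-1 / gamma)]. *)

Lemma powRVK (R : realType) (v g : R) : 0 < v -> 0 < g ->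
  (v `^ (- g^-1)) `^ (- g) = v.
Proof.
by move=> v0 g0; rewrite -powRrM mulrNN mulVf ?gt_eqF// powRr1// ltW.
Qed.

Lemma gt0_gtr_powRN (R : realType) (u v g : R) : 0 < g -> 0 < u -> u < v ->
  v `^ (- g) < u `^ (- g).
Proof.
move=> g0 u0 uv; have v0 : 0 < v := lt_trans u0 uv.
rewrite !powRN ltf_pV2 ?posrE ?powR_gt0//.
by apply: gt0_ltr_powR; rewrite ?nnegrE ?ltW.
Qed.

Definition poisson_cdf (R : realType) (K : nat) (s : R) : R :=
  \sum_(j < K) s ^+ j / j`!%:R * expR (- s).

Section PoissonCdf.
Variable R : realType.
Implicit Types (K : nat) (s u : R).

Lemma poisson_cdfS K s :
  poisson_cdf K.+1 s = poisson_cdf K s + s ^+ K / K`!%:R * expR (- s).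
Proof. by rewrite /poisson_cdf big_ord_recr. Qed.

Lemma is_derive_poisson_cdf K s :
  is_derive s 1 (poisson_cdf K.+1 : R -> R)
    (- (s ^+ K / K`!%:R * expR (- s))).
Proof.
elim: K => [|K IH].
  have -> : poisson_cdf 1 = (fun u => expR (- u)) :> (R -> R).
    apply/funext => u.
    by rewrite /poisson_cdf big_ord1 expr0 fact0 divr1 mul1r.
  apply: is_derive_eq; rewrite expr0 fact0 divr1 mul1r /GRing.scale/=.
  by rewrite mulrN1.
have dE : is_derive s 1 (fun u : R => expR (- u)) (- expR (- s)).
  by apply: is_derive_eq; rewrite /GRing.scale/= mulrN1.
have := is_deriveD IH (is_deriveZ (K.+1`!%:R^-1)
  (is_deriveM (is_deriveX K.+1 (is_derive_id s 1)) dE)).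
have -> : (poisson_cdf K.+1 + K.+1`!%:R^-1 \*: ((id : R -> R) ^+ K.+1 *
    (fun u : R => expR (- u))))%R = poisson_cdf K.+2 :> (R -> R).
  apply/funext => u; rewrite !fctE /= (poisson_cdfS K.+1); congr (_ + _).
  by rewrite /GRing.scale/= mulrA; congr (_ * _); rewrite mulrC.
move=> h; apply: is_derive_eq h _.
rewrite factS natrM !fctE /GRing.scale/= mulr1.
have k0 : K.+1%:R != 0 :> R by rewrite pnatr_eq0.
have f0 : K`!%:R != 0 :> R by rewrite pnatr_eq0 -lt0n fact_gt0.
rewrite exprS; field.
by rewrite f0 nat1r.
Qed.

Lemma continuous_poisson_cdf K : continuous (poisson_cdf K : R -> R).
Proof.
move=> s; case: K => [|K].
  have -> : poisson_cdf 0 = cst 0 :> (R -> R).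
    by apply/funext => u; rewrite /poisson_cdf big_ord0.
  exact: cvg_cst.
apply: differentiable_continuous; apply/derivable1_diffP.
by case: (is_derive_poisson_cdf K s).
Qed.

Lemma poisson_cdf0 K : (0 < K)%N -> poisson_cdf K 0 = 1 :> R.
Proof.
case: K => // K _; rewrite /poisson_cdf big_ord_recl big1 ?addr0 => [|i _].
  by rewrite expr0 fact0 divr1 mul1r oppr0 expR0.
by rewrite exprS !mul0r.
Qed.

Lemma poisson_cdf_ge0 K s : 0 <= s -> 0 <= poisson_cdf K s.
Proof.
move=> s0; apply: sumr_ge0 => i _.
by rewrite mulr_ge0 ?expR_ge0// divr_ge0 ?exprn_ge0.
Qed.

Lemma poisson_cdf_gt0 K s : (0 < K)%N -> 0 <= s -> 0 < poisson_cdf K s.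
Proof.
case: K => // K _ s0; rewrite /poisson_cdf big_ord_recl.
rewrite expr0 fact0 divr1 mul1r ltr_pwDl ?expR_gt0//.
apply: sumr_ge0 => i _.
by rewrite mulr_ge0 ?expR_ge0// divr_ge0 ?exprn_ge0.
Qed.

Lemma poisson_cdf_noninc K s u : 0 <= s -> s <= u ->
  poisson_cdf K u <= poisson_cdf K s.
Proof.
case: K => [|K] s0 su; first by rewrite /poisson_cdf !big_ord0.
apply: (@ler0_derive1_le_cc R _ s u) => //.
- by move=> v _; case: (is_derive_poisson_cdf K v).
- move=> v; rewrite in_itv/= => /andP[sv _].
  rewrite derive1E; have [_ ->] := is_derive_poisson_cdf K v.
  have v0 : 0 <= v by rewrite (le_trans s0)// ltW.
  by rewrite oppr_le0 mulr_ge0 ?expR_ge0// divr_ge0 ?exprn_ge0.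
- exact/continuous_subspaceT/continuous_poisson_cdf.
- by rewrite in_itv/= lexx su.
- by rewrite in_itv/= lexx su.
Qed.

Lemma poisson_cdf_le1 K s : 0 <= s -> poisson_cdf K s <= 1.
Proof.
case: K => [|K] s0; first by rewrite /poisson_cdf !big_ord0.
by rewrite -(poisson_cdf0 (ltn0Sn K)) poisson_cdf_noninc.
Qed.

Lemma poisson_cdf_lt1 K s : 0 < s -> poisson_cdf K s < 1.
Proof.
move=> s0; apply: lt_le_trans (poisson_cdf_le1 K.+1 (ltW s0)).
by rewrite poisson_cdfS ltrDl mulr_gt0 ?expR_gt0// divr_gt0 ?exprn_gt0.
Qed.

Lemma poisson_cdf_le_div K s : 0 < s -> poisson_cdf K s <= K%:R ^+ 2 / s.
Proof.
move=> s0; rewrite /poisson_cdf.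
apply: (@le_trans _ _ (\sum_(j < K) K%:R / s)); last first.
  by rewrite sumr_const card_ord -[_ / _ *+ _]mulr_natl mulrA -expr2.
apply: ler_sum => j _.
rewrite expRN ler_pdivrMr ?expR_gt0// mulrAC ler_pdivlMr//.
have f0 : 0 < j`!%:R :> R by rewrite ltr0n fact_gt0.
have := expR_ge1Dxn j (ltW s0).
rewrite factS natrM => h.
have {}h : s ^+ j.+1 / (j.+1%:R * j`!%:R) <= expR s.
  by apply: le_trans h; rewrite lerDr.
rewrite invfM in h.
apply: (@le_trans _ _ (j.+1%:R * (s ^+ j.+1 * (j.+1%:R^-1 * j`!%:R^-1)))).
  rewrite exprSr le_eqVlt; apply/orP; left; apply/eqP; field.
  by rewrite gt_eqF//= pnatr_eq0.
apply: ler_pM => //.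
  by rewrite mulr_ge0 ?exprn_ge0 ?mulr_ge0 ?invr_ge0// ltW.
by rewrite ler_nat ltn_ord.
Qed.

End PoissonCdf.

Section LimitLaw.
Variable R : realType.

Lemma cdf_probability (f : R -> R) :
  {homo f : u v / u <= v} -> right_continuous f ->
  f @ -oo --> (0 : R) -> f @ +oo --> (1 : R) ->
  exists mu : probability (measurableTypeR R) R,
    forall y, mu `]-oo, y]%classic = (f y)%:E.
Proof.
move=> f_nd f_rc fN f1.
pose fc : cumulativeBounded (0 : R) (1 : R) := HB.pack f
  (isCumulative.Build R _ R f f_nd f_rc)
  (isCumulativeBounded.Build R 0 1 f fN f1).
exists (lebesgue_stieltjes_measure fc) => y.
have := cdf_lebesgue_stieltjes_id fc y.
by rewrite /cdf /distribution /pushforward preimage_id.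
Qed.

Lemma nondegenerate_of_cdf (mu : probability (measurableTypeR R) R) (y : R) :
  (0 < mu `]-oo, y]%classic < 1)%E -> nondegenerate_law mu.
Proof.
move=> /andP[mu0 mu1] a mua.
have [ay|ya] := leP a y.
  move: mu1; rewrite -mua ltNge => /negP; apply.
  apply: le_measure; rewrite ?inE//.
  by move=> z /= ->; rewrite in_itv.
have : (mu `]-oo, y]%classic + mu [set a] <= 1)%E.
  rewrite -measureU//; first by apply: probability_le1; apply: measurableU.
  rewrite -subset0 => z /= [+ za]; rewrite in_itv/= za => /le_lt_trans.
  by move=> /(_ _ ya); rewrite ltxx.
rewrite mua leNgt => /negP; apply.
by rewrite -[ltLHS]add0e lte_leD.
Qed.

(** The distribution function of [(G / c) ^ (-g) - 1], where [G] is the [K]-th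
    point of a unit-rate Poisson process. *)
Definition limit_cdf (K : nat) (c g y : R) : R :=
  if 0 < 1 + y then poisson_cdf K (c * (1 + y) `^ (- g^-1)) else 0.

Variables (K : nat) (c g : R).
Hypotheses (K0 : (0 < K)%N) (c0 : 0 < c) (g0 : 0 < g).

Let rate_gt0 (y : R) : 0 < 1 + y -> 0 < c * (1 + y) `^ (- g^-1).
Proof. by move=> y0; rewrite mulr_gt0// powR_gt0. Qed.

Lemma limit_cdf_ge0 y : 0 <= limit_cdf K c g y.
Proof.
by rewrite /limit_cdf; case: ifPn => // y0; apply/poisson_cdf_ge0/ltW/rate_gt0.
Qed.

Lemma limit_cdf_le1 y : limit_cdf K c g y <= 1.
Proof.
by rewrite /limit_cdf; case: ifPn => // y0; apply/poisson_cdf_le1/ltW/rate_gt0.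
Qed.

Lemma limit_cdf_nondecreasing (u v : R) : u <= v ->
  limit_cdf K c g u <= limit_cdf K c g v.
Proof.
move=> uv; have [u0|u0] := ltP 0 (1 + u); last first.
  rewrite [limit_cdf _ _ _ u]/limit_cdf ltNge u0/=.
  exact: limit_cdf_ge0.
have v0 : 0 < 1 + v by lra.
rewrite /limit_cdf u0 v0; apply: poisson_cdf_noninc; first exact/ltW/rate_gt0.
rewrite ler_pM2l// !powRN lef_pV2 ?posrE ?powR_gt0//.
by apply: ge0_ler_powR; rewrite ?nnegrE ?invr_ge0 ?lerD2l//; exact: ltW.
Qed.

Lemma continuous_limit_cdf (y : R) :
  0 < 1 + y -> {for y, continuous (limit_cdf K c g)}.
Proof.
move=> y0.
have h : poisson_cdf K (c * expR (- g^-1 * ln (1 + z))) @[z --> y] -->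
    poisson_cdf K (c * expR (- g^-1 * ln (1 + y))).
  apply: continuous_cvg; first exact: continuous_poisson_cdf.
  apply: cvgMl_tmp; apply: continuous_cvg; first exact: continuous_expR.
  apply: cvgMl_tmp; apply: continuous_cvg; first exact: continuous_ln.
  by apply: cvgD; [exact: cvg_cst|exact: cvg_id].
have limE z : 0 < 1 + z ->
    limit_cdf K c g z = poisson_cdf K (c * expR (- g^-1 * ln (1 + z))).
  by move=> z0; rewrite /limit_cdf z0 /powR gt_eqF.
suff : limit_cdf K c g z @[z --> y] --> limit_cdf K c g y by [].
rewrite limE//.
apply: cvg_trans h; apply: near_eq_cvg.
near=> z.
have z0 : 0 < 1 + z.
  have : -1 < z by near: z; apply: lt_nbhsr; lra.
  lra.
by rewrite limE.
Unshelve. all: by end_near. Qed.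

Lemma limit_cdf_at s : 0 < s ->
  limit_cdf K c g ((s / c) `^ (- g) - 1) = poisson_cdf K s.
Proof.
move=> s0; rewrite /limit_cdf addrC subrK powR_gt0 ?divr_gt0//.
have -> : ((s / c) `^ (- g)) `^ (- g^-1) = s / c.
  by rewrite -{1}[g]invrK powRVK ?invr_gt0 ?divr_gt0.
by rewrite mulrC divfK// gt_eqF.
Qed.

Lemma limit_cdf_small e : 0 < e -> exists2 y, -1 < y & limit_cdf K c g y <= e.
Proof.
move=> e0; pose s := K%:R ^+ 2 / e.
have s0 : 0 < s by rewrite divr_gt0// exprn_gt0// ltr0n.
exists ((s / c) `^ (- g) - 1).
  by have := powR_gt0 (-g) (divr_gt0 s0 c0); lra.
rewrite limit_cdf_at//; apply: le_trans (poisson_cdf_le_div _ s0) _.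
by rewrite /s invf_div mulrC divfK// gt_eqF// exprn_gt0// ltr0n.
Qed.

Lemma limit_cdf_big e : 0 < e -> exists y, 1 - e <= limit_cdf K c g y.
Proof.
move=> e0.
have := @continuous_poisson_cdf R K 0; rewrite /continuous_at poisson_cdf0//.
move=> /cvgr_dist_le/(_ _ e0).
rewrite near_simpl => /nbhs_ballP[r /= r0 /(_ (r / 2))].
rewrite /ball/= sub0r normrN gtr0_norm ?divr_gt0// => h.
exists ((r / 2 / c) `^ (- g) - 1); rewrite limit_cdf_at ?divr_gt0//.
have {}h := h ltac:(lra).
by have := ler_norm (1 - poisson_cdf K (r / 2)); lra.
Qed.

Lemma limit_law_exists : exists mu : probability (measurableTypeR R) R,
  forall y, mu `]-oo, y]%classic = (limit_cdf K c g y)%:E.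
Proof.
apply: cdf_probability; first exact: limit_cdf_nondecreasing.
- move=> y; have [y0|y0|y0] := ltgtP y (-1).
  + have -> : limit_cdf K c g y = 0.
      by rewrite /limit_cdf ifF//; apply/negP; lra.
    apply: cvg_near_cst.
    near=> z; rewrite /limit_cdf ifF//; apply/negP.
    have : z < -1 by near: z; exact: nbhs_right_lt.
    lra.
  + apply: cvg_within_filter; apply: continuous_limit_cdf; lra.
  + rewrite y0; have -> : limit_cdf K c g (-1) = 0.
      by rewrite /limit_cdf subrr ltxx.
    apply/cvgrPdist_le => e e0; have [z z1 ze] := limit_cdf_small e0.
    near=> u; rewrite sub0r normrN ger0_norm; last exact: limit_cdf_ge0.
    apply: le_trans ze; apply: limit_cdf_nondecreasing.
    by near: u; apply: nbhs_right_le.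
- apply: cvg_near_cst.
  near=> z; rewrite /limit_cdf ifF//; apply/negP.
  have : z < -1 by near: z; apply: nbhs_ninfty_lt; rewrite num_real.
  lra.
- apply/cvgrPdist_le => e e0; have [z ze] := limit_cdf_big e0.
  near=> u; have zu : z <= u.
    by near: u; apply: nbhs_pinfty_ge; rewrite num_real.
  rewrite ger0_norm ?subr_ge0 ?limit_cdf_le1//.
  have h := limit_cdf_nondecreasing zu.
  by rewrite lerBlDr -lerBlDl (le_trans ze).
Unshelve. all: by end_near. Qed.

End LimitLaw.

Section BinomialPoisson.
Variables (R : realType) (m : nat -> nat).
Implicit Types (l u : nat -> R) (a b : R).

Lemma cvg_binomial_expn l a (j : nat) :
  l n @[n --> \oo] --> (0 : R) -> (m n)%:R * l n @[n --> \oo] --> a ->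
  'C(m n, j)%:R * l n ^+ j @[n --> \oo] --> a ^+ j / j`!%:R.
Proof.
move=> l0 ml; elim: j => [|j IH].
  under eq_cvg do rewrite bin0 expr0 mulr1.
  by rewrite expr0 fact0 divr1; exact: cvg_cst.
have binE n : 'C(m n, j.+1)%:R * l n ^+ j.+1 =
    'C(m n, j)%:R * l n ^+ j * (((m n)%:R * l n - j%:R * l n) / j.+1%:R).
  have j0 : j.+1%:R != 0 :> R by rewrite pnatr_eq0.
  have : j.+1%:R * 'C(m n, j.+1)%:R = ((m n)%:R - j%:R) * 'C(m n, j)%:R :> R.
    rewrite -natrM mul_bin_left natrM.
    have [jm|mj] := leqP j (m n); first by rewrite natrB.
    by rewrite bin_small// !mulr0.
  move/(congr1 (fun v : R => v / j.+1%:R)); rewrite mulrAC divff// mul1r => ->.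
  by rewrite exprS; field; rewrite nat1r.
under eq_cvg do rewrite binE.
have -> : a ^+ j.+1 / j.+1`!%:R = a ^+ j / j`!%:R * ((a - j%:R * 0) / j.+1%:R).
  by rewrite factS natrM exprS; field; rewrite nat1r !pnatr_eq0 -!lt0n fact_gt0.
by apply: cvgM => //; apply: cvgMr_tmp; apply: cvgB => //; apply: cvgMl_tmp.
Qed.

Lemma expr_1B_le_expR (v : R) (k : nat) : v <= 1 ->
  (1 - v) ^+ k <= expR (- (k%:R * v)).
Proof.
move=> v1; rewrite -mulrN expRM_natl.
apply: lerXn2r; rewrite ?nnegrE ?subr_ge0 ?expR_ge0//.
exact: expR_ge1Dx.
Qed.

Lemma expR_le_expr_1B (v : R) (k : nat) : v < 1 ->
  expR (- (k%:R * v / (1 - v))) <= (1 - v) ^+ k.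
Proof.
move=> v1; have v10 : 0 < 1 - v by rewrite subr_gt0.
rewrite -mulrA -mulrN expRM_natl.
apply: lerXn2r; rewrite ?nnegrE ?expR_ge0 ?(ltW v10)//.
rewrite expRN -[leRHS]invrK lef_pV2 ?posrE ?expR_gt0 ?invr_gt0//.
apply: le_trans (expR_ge1Dx _).
by rewrite le_eqVlt; apply/orP; left; apply/eqP; field; rewrite gt_eqF.
Qed.

Lemma cvg_expr_1B u b (j : nat) :
  (forall n, 0 <= u n) ->
  u n @[n --> \oo] --> (0 : R) -> (m n)%:R * u n @[n --> \oo] --> b ->
  (\forall n \near \oo, (j <= m n)%N) ->
  (1 - u n) ^+ (m n - j) @[n --> \oo] --> expR (- b).
Proof.
move=> u_ge0 u0 mu jm.
apply: (@squeeze_cvgr _ _ _ _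
    (fun n => expR (- ((m n)%:R * u n / (1 - u n))))
    (fun n => expR (- ((m n)%:R * u n - j%:R * u n)))).
- near=> n.
  have u1 : u n < 1 by near: n; apply: cvgr_lt u0 _ _; exact: ltr01.
  have jmn : (j <= m n)%N by near: n.
  apply/andP; split.
    apply: le_trans (expR_le_expr_1B _ u1) _.
    apply: ler_wiXn2l; rewrite ?leq_subr// ?subr_ge0 ?gerBl ?u_ge0 ?(ltW u1)//.
  by rewrite /= -mulrBl -natrB// expr_1B_le_expR// ltW.
- apply: continuous_cvg; first exact: continuous_expR.
  have -> : b = b / (1 - 0) by rewrite subr0 divr1.
  apply: cvgN; apply: cvgM => //.
  apply: cvgV; first by rewrite subr0 oner_eq0.
  by apply: cvgB => //; exact: cvg_cst.
- apply: continuous_cvg; first exact: continuous_expR.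
  have -> : b = b - j%:R * 0 by rewrite mulr0 subr0.
  by apply: cvgN; apply: cvgB => //; exact: cvgMl_tmp.
Unshelve. all: by end_near. Qed.

Lemma cvg_binomial_sum (K : nat) l u a b :
  (forall n, 0 <= u n) -> (forall k, \forall n \near \oo, (k <= m n)%N) ->
  l n @[n --> \oo] --> (0 : R) -> (m n)%:R * l n @[n --> \oo] --> a ->
  u n @[n --> \oo] --> (0 : R) -> (m n)%:R * u n @[n --> \oo] --> b ->
  \sum_(j < K) 'C(m n, j)%:R * l n ^+ j * (1 - u n) ^+ (m n - j)
    @[n --> \oo] --> poisson_cdf K a * expR (a - b).
Proof.
move=> u_ge0 moo l0 ml u0 mu.
have -> : poisson_cdf K a * expR (a - b) =
    \sum_(j < K) a ^+ j / j`!%:R * expR (- b).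
  rewrite /poisson_cdf mulr_suml; apply: eq_bigr => j _.
  by rewrite -mulrA -expRD addKr.
apply: cvg_big => [|j _]; first exact: add_continuous.
by apply: cvgM; [exact: cvg_binomial_expn|exact: cvg_expr_1B].
Qed.

End BinomialPoisson.

Section ExceedanceCounts.
Variables (R : realType) (d : measure_display) (T : measurableType d).
Variables (P : probability T R) (I : finType) (Y : I -> {RV P >-> R}).
Variables (S : {set I}) (z : R).

Definition exceedances (w : T) : {set I} := [set i in S | z < Y i w].

Definition half_line (J : {set I}) (i : I) : set R :=
  if i \in J then `]z, +oo[%classic else `]-oo, z]%classic.

Lemma measurable_half_line (J : {set I}) (i : I) : measurable (half_line J i).
Proof. by rewrite /half_line; case: ifP. Qed.

Lemma exceedances_eqE (J : {set I}) : J \subset S ->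
  [set w | exceedances w = J] =
  \bigcap_(i in [set` S]) (Y i @^-1` half_line J i).
Proof.
move=> JS; apply/seteqP; split => w /=.
  move=> <- i /= iS; rewrite /half_line inE -/(is_true (i \in S)) iS/=.
  by case: ltP => zY /=; rewrite in_itv/= ?andbT.
move=> h; apply/setP => i; rewrite !inE.
have [iS|iS] /= := boolP (i \in S); last first.
  by apply/esym/negbTE; apply: contra iS; exact: (fintype.subsetP JS).
have := h i iS; rewrite /half_line.
case: ifP => _ /=; rewrite in_itv/= ?andbT//.
by move=> zY; rewrite ltNge zY.
Qed.

Lemma measurable_exceedances_eq (J : {set I}) : J \subset S ->
  measurable [set w | exceedances w = J].
Proof.
move=> JS; rewrite exceedances_eqE//.
apply: fin_bigcap_measurable; first exact: finite_finset.
move=> i _; rewrite -[X in measurable X]setTI.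
by apply: measurable_funP => //; exact: measurable_half_line.
Qed.

Lemma few_exceedancesE (K : nat) :
  [set w | (#|exceedances w| < K)%N] =
  \bigcup_(J in [set` enum [set J : {set I} | J \subset S & (#|J| < K)%N]])
    [set w | exceedances w = J].
Proof.
apply/seteqP; split => w /=.
  move=> wK; exists (exceedances w) => //=.
  rewrite mem_enum inE wK andbT; apply/fintype.subsetP => i.
  by rewrite inE => /andP[].
by move=> [J /=]; rewrite mem_enum inE => /andP[_ JK] ->.
Qed.

Lemma measurable_few_exceedances (K : nat) :
  measurable [set w | (#|exceedances w| < K)%N].
Proof.
rewrite few_exceedancesE; apply: fin_bigcup_measurable => // J /=.
by rewrite mem_enum inE => /andP[JS _]; exact: measurable_exceedances_eq.
Qed.

Hypothesis indepY : mutually_independent P (fun i => Y i : T -> R).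

Variable p : I -> R.
Hypothesis pE : forall i, P (Y i @^-1` `]-oo, z]) = (1 - p i)%:E.

Lemma prob_exceed (i : I) : P (Y i @^-1` `]z, +oo[) = (p i)%:E.
Proof.
have mY : measurable (Y i @^-1` `]-oo, z]%classic).
  by rewrite -[X in measurable X]setTI; apply: measurable_funP.
have -> : Y i @^-1` `]z, +oo[ = ~` (Y i @^-1` `]-oo, z]).
  by rewrite preimage_setC setCitvl.
by rewrite probability_setC// pE -EFinB opprB addrC subrK.
Qed.

Lemma prob_exceedances_eq (J : {set I}) : J \subset S ->
  P [set w | exceedances w = J] =
    (\prod_(i in J) p i * \prod_(i in S :\: J) (1 - p i))%:E.
Proof.
move=> JS; rewrite exceedances_eqE// indepY; last exact: measurable_half_line.
rewrite (eq_bigr (fun i => (if i \in J then p i else 1 - p i)%:E)); last first.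
  by move=> i _; rewrite /half_line; case: ifP => _; rewrite ?prob_exceed ?pE.
rewrite prodEFin (big_setID J)/= (finset.setIidPr JS).
congr ((_ * _)%:E); apply: eq_bigr => i; first by move=> ->.
by rewrite inE => /andP[/negbTE ->].
Qed.

Lemma prob_few_exceedances (K : nat) :
  P [set w | (#|exceedances w| < K)%N] =
    (\sum_(j < K) \sum_(J : {set I} | (J \subset S) && (#|J| == j))
      \prod_(i in J) p i * \prod_(i in S :\: J) (1 - p i))%:E.
Proof.
rewrite few_exceedancesE measure_fin_bigcup//; last 2 first.
- by move=> J1 J2 _ _ [w [/= <- <-]].
- move=> J /=; rewrite mem_enum inE => /andP[JS _].
  exact: measurable_exceedances_eq.
rewrite -fsbig_seq ?enum_uniq// big_enum/=.
under eq_bigr => J.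
  by rewrite inE => /andP[JS _]; rewrite prob_exceedances_eq//; over.
rewrite sumEFin; congr EFin.
rewrite (eq_bigl (fun J : {set I} => (J \subset S) && (#|J| < K)%N));
  last by move=> J; rewrite inE.
case: K => [|K].
  by rewrite big_ord0 big_pred0// => J; rewrite andbF.
rewrite (partition_big (fun J : {set I} => inord #|J| : 'I_K.+1) xpredT)//=.
apply: eq_bigr => j _; apply: eq_bigl => J.
rewrite -andbA; congr (_ && _).
apply/andP/eqP => [[JK /eqP/(congr1 val)/=]|Jj].
  by rewrite inordK.
by rewrite Jj ltn_ord; split => //; apply/eqP/val_inj; rewrite /= inordK.
Qed.

Lemma prob_few_exceedances_bounds (K : nat) (l u : R) :
  0 <= l -> u <= 1 -> (forall i, i \in S -> l <= p i <= u) ->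
  ((\sum_(j < K) 'C(#|S|, j)%:R * l ^+ j * (1 - u) ^+ (#|S| - j))%:E
    <= P [set w | (#|exceedances w| < K)%N]
    <= (\sum_(j < K) 'C(#|S|, j)%:R * u ^+ j * (1 - l) ^+ (#|S| - j))%:E)%E.
Proof.
move=> l0 u1 plu; rewrite prob_few_exceedances !lee_fin.
have sumE (a b : R) (j : nat) :
    'C(#|S|, j)%:R * a ^+ j * b ^+ (#|S| - j) =
    \sum_(J : {set I} | (J \subset S) && (#|J| == j))
      \prod_(i in J) a * \prod_(i in S :\: J) b.
  rewrite -cards_draws -mulrA mulr_natl -sumr_const.
  apply: eq_big => [J|J /[!inE] /andP[JS /eqP Jj]]; first by rewrite inE.
  by rewrite !prodr_const cardsDS// Jj.
have pj (J : {set I}) i : J \subset S -> i \in J -> l <= p i <= u.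
  by move=> JS /(fintype.subsetP JS); exact: plu.
have pSj (J : {set I}) i : i \in S :\: J -> l <= p i <= u.
  by rewrite inE => /andP[_]; exact: plu.
apply/andP; split; apply: ler_sum => j _; rewrite sumE;
    apply: ler_sum => J /andP[JS _].
- apply: ler_pM; rewrite ?prodr_ge0 ?subr_ge0//.
  + by apply: ler_prod => i /(pj _ _ JS)/andP[lp _]; rewrite l0.
  + by apply: ler_prod => i /pSj/andP[_ pu]; rewrite subr_ge0 u1 lerD2l lerN2.
- apply: ler_pM.
  + by apply: prodr_ge0 => i /(pj _ _ JS)/andP[lp _]; exact: le_trans lp.
  + apply: prodr_ge0 => i /pSj/andP[_ pu]; rewrite subr_ge0.
    exact: le_trans pu u1.
  + by apply: ler_prod => i /(pj _ _ JS)/andP[lp ->]; rewrite (le_trans l0).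
  + apply: ler_prod => i /pSj/andP[lp pu]; rewrite subr_ge0.
    by rewrite (le_trans pu u1) lerD2l lerN2.
Qed.

End ExceedanceCounts.

Lemma order_stat_le (R : realType) (s : seq R) (k : nat) (z : R) :
  (0 < k <= size s)%N ->
  (order_stat k s <= z) = (count (> z) s <= size s - k)%N.
Proof.
move=> /andP[k0 ks]; rewrite /order_stat.
have sorted_s : sorted <=%R (sort <=%R s) := sort_sorted le_total s.
have /permPl/permP cE := perm_sort <=%R s.
have cC : (count (<= z) s + count (> z) s = size s)%N.
  rewrite -(count_predC (<= z) s); congr (_ + _)%N; apply: eq_count => v /=.
  by rewrite ltNge.
have [kc|ck] := ltnP k.-1 (count (<= z) s).
  rewrite nth_count_le ?cE//.
  apply/esym; lia.
have kN : (k.-1 < size s)%N by rewrite prednK.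
rewrite leNgt nth_count_gt ?cE ?size_sort ?ck ?kN//=.
apply/esym/negbTE; rewrite -ltnNge; move: cC ck.
by move: (count (<= z) s) (count (> z) s) => a b; lia.
Qed.

Section ConditionalTails.
Variables (R : realType) (E : metricType R).
Variables (F : E -> cumulativeBounded (0 : R) (1 : R)) (q : R -> E -> R).
Hypothesis Fq : conditional_quantile F q.

Lemma tail_le (x : E) (a z : R) : 0 < a < 1 -> q a x <= z -> 1 - F x z <= a.
Proof.
move=> a01 qz; have [_ Fqa] := Fq x a01.
have : F x (q a x) <= F x z by exact: cumulative_is_nondecreasing.
by rewrite Fqa; lra.
Qed.

Lemma tail_ge (x : E) (a z : R) : 0 < a < 1 -> z <= q a x -> a <= 1 - F x z.
Proof.
move=> a01 zq; have [_ Fqa] := Fq x a01.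
have : F x z <= F x (q a x) by exact: cumulative_is_nondecreasing.
by rewrite Fqa; lra.
Qed.

Lemma cdf_le0 (x : E) (z : R) : z <= 0 -> F x z <= 0.
Proof.
move=> z0; apply/ler_addgt0Pr => e e0; rewrite add0r.
have a01 : 0 < 1 - Num.min e (1 / 2) < 1.
  by rewrite /Num.min; case: ifP => ?; lra.
have [/ltW q0 _] := Fq x a01.
have := tail_ge a01 (le_trans z0 q0).
by rewrite /Num.min; case: ifP => ?; lra.
Qed.

Lemma oscillation_le (t : E) (r a b e : R) (x x' : E) :
  (oscillation q t r a <= e%:E)%E -> 0 < b < 1 -> a < b < 1 - a ->
  cball t r x -> cball t r x' -> q b x <= expR e * q b x'.
Proof.
move=> osc b01 ab tx tx'.
have [qx _] := Fq x b01; have [qx' _] := Fq x' b01.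
have : (`|ln (q b x / q b x')|%:E <= e%:E)%E.
  by apply: le_trans osc; apply: ereal_sup_ubound; exists b, x, x'.
rewrite lee_fin => h; rewrite -ler_pdivrMr// -[leLHS]lnK ?posrE ?divr_gt0//.
by rewrite ler_expR (le_trans (ler_norm _)).
Qed.

End ConditionalTails.

Lemma mul_expR_lt (R : realType) (v w : R) : 0 < w -> w < v ->
  exists2 e : R, 0 < e & w * expR e < v.
Proof.
move=> w0 wv; have v0 : 0 < v := lt_trans w0 wv.
exists ((v - w) / (2 * v)); first by rewrite divr_gt0 ?subr_gt0 ?mulr_gt0.
rewrite -ltr_pdivlMr ?expR_gt0// -expRN.
apply: (@lt_le_trans _ _ (v * (1 - (v - w) / (2 * v)))).
  have -> : v * (1 - (v - w) / (2 * v)) = (v + w) / 2.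
    by field; rewrite gt_eqF.
  lra.
by rewrite ler_pM2l// expR_ge1Dx.
Qed.

Section UniformQuantiles.
Variables (R : realType) (E : metricType R).
Variables (F : E -> cumulativeBounded (0 : R) (1 : R)) (q : R -> E -> R).
Variables (gamma : E -> R) (t : E) (h : nat -> R) (c : R) (alpha : nat -> R).
Variable m : nat -> nat.
Hypothesis Fq : conditional_quantile F q.
Hypothesis q_heavy : heavy_tailed q gamma.
Hypothesis h_gt0 : forall n, 0 < h n.
Hypothesis c_ge1 : 1 <= c.
Hypothesis alpha01 : forall n, 0 < alpha n < 1.
Hypothesis alpha0 : alpha n @[n --> \oo] --> (0 : R).
Hypothesis malpha : (m n)%:R * alpha n @[n --> \oo] --> c.

Let c_gt_half : 1 / 2 < c.
Proof. by apply: lt_le_trans c_ge1; rewrite ltr_pdivrMr// mul1r ltr1n. Qed.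

Lemma local_count_infty (A : R) : \forall n \near \oo, A <= (m n)%:R.
Proof.
near=> n.
have /andP[a0 _] := alpha01 n.
have ma : 1 / 2 < (m n)%:R * alpha n.
  near: n; apply: cvgr_gt malpha _ _; exact: c_gt_half.
have A0 : 0 < 2 * (`|A| + 1) by have := normr_ge0 A; lra.
have aA : alpha n < (2 * (`|A| + 1))^-1.
  by near: n; apply: cvgr_lt alpha0 _ _; rewrite invr_gt0.
have {}aA : alpha n * (2 * (`|A| + 1)) < 1 by rewrite -ltr_pdivlMr// mul1r.
rewrite -(ler_pM2r a0).
have := ler_norm A; rewrite -(ler_pM2r a0) => Aa; nra.
Unshelve. all: by end_near. Qed.

Variable delta : R.
Hypothesis delta0 : 0 < delta.
Hypothesis osc0 :
  oscillation q t (h n) ((m n)%:R `^ (- (1 + delta))) @[n --> \oo] --> 0%E.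

Lemma quantile_order_range (la : R) : 0 < la ->
  \forall n \near \oo,
    (m n)%:R `^ (- (1 + delta)) < la * alpha n
      < 1 - (m n)%:R `^ (- (1 + delta)).
Proof.
move=> la0; near=> n.
have ma : 1 / 2 < (m n)%:R * alpha n.
  by near: n; apply: cvgr_gt malpha _ _; exact: c_gt_half.
have a4 : alpha n < (4 * la)^-1.
  by near: n; apply: cvgr_lt alpha0 _ _; rewrite invr_gt0 mulr_gt0.
have m2 : 2 <= (m n)%:R :> R by near: n; exact: local_count_infty.
have m0 : 0 < (m n)%:R :> R by lra.
pose e := Num.min 1 (la / 4).
have e0 : 0 < e by rewrite lt_min ltr01 divr_gt0.
have me : (m n)%:R `^ (- delta) <= e.
  have : e `^ (- delta^-1) <= (m n)%:R by near: n; exact: local_count_infty.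
  have /ge0_ler_powR H : 0 <= delta by exact: ltW.
  move=> /H; rewrite !nnegrE powR_ge0 ltW// => /(_ isT isT).
  rewrite -powRrM mulNr mulVf ?gt_eqF// powR_inv1 ?(ltW e0)// => em.
  by rewrite powRN invf_ple ?posrE ?powR_gt0.
have -> : (m n)%:R `^ (- (1 + delta)) = (m n)%:R^-1 * (m n)%:R `^ (- delta).
  by rewrite opprD powRD ?(gt_eqF m0) ?implybT// powR_inv1// ltW.
have me' : (m n)%:R^-1 * (m n)%:R `^ (- delta) <= (m n)%:R^-1 * e.
  by rewrite ler_pM2l// invr_gt0.
have e1 : e <= 1 by rewrite ge_min lexx.
have e4 : e <= la / 4 by rewrite ge_min lexx orbT.
have mV : (m n)%:R^-1 * (m n)%:R = 1 :> R by rewrite mulVf// gt_eqF.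
have mV0 : 0 < (m n)%:R^-1 :> R by rewrite invr_gt0.
apply/andP; split; apply: le_lt_trans.
- exact: me'.
- have : (m n)%:R^-1 * (1 / 2) < (m n)%:R^-1 * ((m n)%:R * alpha n).
    by rewrite ltr_pM2l.
  by rewrite [ltRHS]mulrA mV mul1r => ?; nra.
- exact: lexx.
- rewrite ltrBrDl -ltrBrDr; apply: le_lt_trans me' _.
  have : alpha n * (4 * la) < 1 by rewrite -ltr_pdivlMr ?mulr_gt0// mul1r.
  nra.
Unshelve. all: by end_near. Qed.

Lemma quantile_ball (la e : R) : 0 < la -> 0 < e ->
  \forall n \near \oo, forall x, cball t (h n) x ->
    q (la * alpha n) x <= expR e * q (la * alpha n) t /\
    q (la * alpha n) t <= expR e * q (la * alpha n) x.
Proof.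
move=> la0 e0; near=> n => x tx.
have tt : cball t (h n) t by rewrite /cball/= mdistxx ltW.
have ab : (m n)%:R `^ (- (1 + delta)) < la * alpha n
    < 1 - (m n)%:R `^ (- (1 + delta)).
  by near: n; exact: quantile_order_range.
have osc : (oscillation q t (h n) ((m n)%:R `^ (- (1 + delta))) <= e%:E)%E.
  by apply: ltW; near: n; apply: (osc0 (open_ereal_lt' _)); rewrite lte_fin.
have b01 : 0 < la * alpha n < 1.
  by have := powR_ge0 ((m n)%:R : R) (- (1 + delta)); lra.
by split; apply: (oscillation_le Fq osc).
Unshelve. all: by end_near. Qed.

Lemma cvg_quantile_ratio (la : R) : 0 < la ->
  q (la * alpha n) t / q (alpha n) t @[n --> \oo] --> la `^ (- gamma t).
Proof.
move=> la0; have [_ /(_ _ la0) H] := q_heavy t.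
apply: cvg_comp H; move=> A.
rewrite /at_right withinE/= => -[B B0 /= BA].
have : \forall n \near \oo, B (alpha n) by exact: alpha0.
apply: filterS => n Bn; have /andP[a0 _] := alpha01 n.
have : (B `&` [set u | 0 < u]) (alpha n) by [].
by rewrite -BA => -[].
Qed.

Lemma tail_prob_le (la v : R) : 0 < la -> 0 < v -> la `^ (- gamma t) < v ->
  \forall n \near \oo, forall x, cball t (h n) x ->
    1 - F x (v * q (alpha n) t) <= la * alpha n.
Proof.
move=> la0 v0 lav.
have [e e0 le_v] := mul_expR_lt (powR_gt0 (- gamma t) la0) lav.
near=> n => x tx.
have QB : forall x, cball t (h n) x ->
    q (la * alpha n) x <= expR e * q (la * alpha n) t /\
    q (la * alpha n) t <= expR e * q (la * alpha n) x.
  by near: n; exact: quantile_ball.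
have [qt _] := Fq t (alpha01 n).
have b01 : 0 < la * alpha n < 1.
  have /andP[a0 _] := alpha01 n; rewrite mulr_gt0//=.
  rewrite mulrC -ltr_pdivlMr// div1r.
  by near: n; apply: cvgr_lt alpha0 _ _; rewrite invr_gt0.
apply: (tail_le Fq) => //.
have r : q (la * alpha n) t / q (alpha n) t <= v * expR (- e).
  near: n; apply: cvgr_le (cvg_quantile_ratio la0) _ _.
  by rewrite expRN ltr_pdivlMr ?expR_gt0.
rewrite ler_pdivrMr// mulrAC expRN ler_pdivlMr ?expR_gt0// mulrC in r.
exact: le_trans (QB _ tx).1 r.
Unshelve. all: by end_near. Qed.

Lemma tail_prob_ge (la v : R) : 0 < la -> 0 < v -> v < la `^ (- gamma t) ->
  \forall n \near \oo, forall x, cball t (h n) x ->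
    la * alpha n <= 1 - F x (v * q (alpha n) t).
Proof.
move=> la0 v0 lav.
have [e e0 le_v] := mul_expR_lt v0 lav.
near=> n => x tx.
have QB : forall x, cball t (h n) x ->
    q (la * alpha n) x <= expR e * q (la * alpha n) t /\
    q (la * alpha n) t <= expR e * q (la * alpha n) x.
  by near: n; exact: quantile_ball.
have [qt _] := Fq t (alpha01 n).
have b01 : 0 < la * alpha n < 1.
  have /andP[a0 _] := alpha01 n; rewrite mulr_gt0//=.
  rewrite mulrC -ltr_pdivlMr// div1r.
  by near: n; apply: cvgr_lt alpha0 _ _; rewrite invr_gt0.
apply: (tail_ge Fq) => //.
have r : v * expR e <= q (la * alpha n) t / q (alpha n) t.
  by near: n; apply: cvgr_ge (cvg_quantile_ratio la0) _ _.
rewrite ler_pdivlMr// mulrAC in r.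
by have := le_trans r (QB _ tx).2; rewrite mulrC ler_pM2l ?expR_gt0.
Unshelve. all: by end_near. Qed.

End UniformQuantiles.

Section LocalSample.
Variables (R : realType) (E : metricType R).
Variables (n : nat) (x : 'I_n -> E) (t : E) (r : R).
Implicit Types (y : 'I_n -> R) (z : R).

Definition local_indices : {set 'I_n} := [set i | x i \in cball t r]%SET.

Lemma card_local_indices : #|local_indices| = local_count x t r.
Proof.
rewrite /local_count -sum1_card big_mkcond; apply: eq_bigr => i _.
by rewrite inE; case: (x i \in _).
Qed.

Lemma count_local_sample y (p : pred R) :
  count p (local_sample x y t r) = #|[set i in local_indices | p (y i)]|.
Proof.
rewrite /local_sample count_map count_filter enumT cardE /enum_mem size_filter.
by apply: eq_count => i /=; rewrite !inE andbC.
Qed.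

Lemma size_local_sample y : size (local_sample x y t r) = local_count x t r.
Proof.
rewrite -card_local_indices -(count_predT (local_sample _ _ _ _)).
rewrite count_local_sample; apply: eq_card => i.
by rewrite !inE andbT.
Qed.

Lemma order_stat_local_sample_le y (k : nat) (z : R) :
  (0 < k <= local_count x t r)%N ->
  (order_stat k (local_sample x y t r) <= z) =
  (#|[set i in local_indices | (z < y i)%R]| <= local_count x t r - k)%N.
Proof.
by move=> km; rewrite order_stat_le ?size_local_sample// count_local_sample.
Qed.

Lemma qhat1_le y (a z : R) (k : nat) :
  k = Num.truncn ((local_count x t r)%:R * a) ->
  (0 < k <= local_count x t r)%N ->
  (qhat1 x y t r a <= z) = (#|[set i in local_indices | (z < y i)%R]| < k)%N.
Proof.
move=> kE /andP[k0 km]; rewrite /qhat1 -kE order_stat_local_sample_le; last lia.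
by rewrite addn1 subnS subKn// -ltnS prednK.
Qed.

Lemma measurable_order_stat_local_sample (d : measure_display)
    (T : measurableType d) (P : probability T R) (Y : 'I_n -> {RV P >-> R}) (k : nat) : (0 < k)%N ->
  measurable_fun [set: T]
    (fun w => order_stat k (local_sample x (fun i => Y i w) t r)).
Proof.
move=> k0; have [km|mk] := leqP k (local_count x t r); last first.
  rewrite (_ : (fun w => _) = cst 0); first exact: measurable_cst.
  apply/funext => w; rewrite /order_stat nth_default// size_sort.
  by rewrite size_local_sample -ltnS prednK.
apply: (measurability (@RGenOInfty.G R)).
  exact: RGenOInfty.measurableE.
move=> /= _ [_] [z] -> <-.
rewrite setTI -setCitvl -preimage_setC; apply: measurableC.
rewrite [X in measurable X](_ : _ =
    [set w | (#|exceedances Y local_indices z w|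
                < (local_count x t r - k).+1)%N]).
  exact: measurable_few_exceedances.
apply/seteqP; split => w /=;
  by rewrite in_itv/= order_stat_local_sample_le ?k0// ltnS.
Qed.

End LocalSample.

Section PoissonLimit.
Variables (R : realType) (d : measure_display) (T : measurableType d).
Variables (P : probability T R) (Y : forall n, 'I_n -> {RV P >-> R}).
Variables (S : forall n, {set 'I_n}) (z : nat -> R).
Variables (p : forall n, 'I_n -> R) (alpha : nat -> R) (c v : R).
Hypothesis indepY :
  forall n, mutually_independent P (fun i => Y i : T -> R) (I := 'I_n).
Hypothesis pE : forall n (i : 'I_n), P (Y i @^-1` `]-oo, z n]) = (1 - p i)%:E.
Hypothesis alpha_gt0 : forall n, 0 < alpha n.
Hypothesis alpha0 : alpha n @[n --> \oo] --> (0 : R).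
Hypothesis Salpha : #|S n|%:R * alpha n @[n --> \oo] --> c.
Hypothesis Soo : forall k, \forall n \near \oo, (k <= #|S n|)%N.
Hypothesis v0 : 0 < v.
Hypothesis p_ge : forall la, 0 < la -> la < v ->
  \forall n \near \oo, forall i, i \in S n -> la * alpha n <= p i.
Hypothesis p_le : forall la, v < la ->
  \forall n \near \oo, forall i, i \in S n -> p i <= la * alpha n.

Lemma cvg_few_exceedances (K : nat) :
  P [set w | (#|exceedances (@Y n) (S n) (z n) w| < K)%N] @[n --> \oo]
    --> (poisson_cdf K (c * v))%:E.
Proof.
apply/fine_cvgP; split.
  near=> n; apply: fin_num_measure; exact: measurable_few_exceedances.
apply/cvgrPdist_lt => e e0.
pose bnd (s : R) (u : R) :=
  poisson_cdf K (c * (v + s * u)) * expR (c * (v + s * u) - c * (v - s * u)).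
have cvg_bnd s : bnd s u @[u --> 0^'+] --> poisson_cdf K (c * v).
  have -> : poisson_cdf K (c * v) = bnd s 0.
    by rewrite /bnd mulr0 subr0 addr0 subrr expR0 mulr1.
  apply: cvg_within_filter.
  have su : s * u @[u --> (0 : R)] --> s * 0 by apply: cvgMl_tmp; exact: cvg_id.
  have lin1 : c * (v + s * u) @[u --> (0 : R)] --> c * (v + s * 0).
    by apply: cvgMl_tmp; apply: cvgD => //; exact: cvg_cst.
  have lin2 : c * (v - s * u) @[u --> (0 : R)] --> c * (v - s * 0).
    by apply: cvgMl_tmp; apply: cvgB => //; exact: cvg_cst.
  apply: cvgM; apply: continuous_cvg => //.
  - exact: continuous_poisson_cdf.
  - exact: continuous_expR.
  - exact: cvgB.
have scale_cvg0 la : la * alpha n @[n --> \oo] --> (0 : R).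
  by rewrite -(mulr0 la); exact: cvgMl_tmp.
have scale_cvg la : #|S n|%:R * (la * alpha n) @[n --> \oo] --> c * la.
  under eq_cvg do rewrite mulrCA.
  by rewrite mulrC; exact: cvgMl_tmp.
near (0 : R)^'+ => u.
have u0 : 0 < u by [].
have uv : u < v by near: u; exact: nbhs_right_lt.
have lo0 : 0 < v - u by rewrite subr_gt0.
have hi0 : 0 < v + u by rewrite addr_gt0.
have lo_lt : poisson_cdf K (c * v) - e < bnd (-1) u.
  by near: u; apply: cvgr_gt (cvg_bnd (-1)) _ _; rewrite ltrBlDr ltrDl.
have hi_lt : bnd 1 u < poisson_cdf K (c * v) + e.
  by near: u; apply: cvgr_lt (cvg_bnd 1) _ _; rewrite ltrDl.
rewrite /bnd !mulN1r opprK in lo_lt; rewrite /bnd !mul1r in hi_lt.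
near=> n.
have pS i : i \in S n -> (v - u) * alpha n <= p i <= (v + u) * alpha n.
  move=> iS; apply/andP; split.
    move: i iS; near: n; by apply: p_ge; rewrite // gtrBl.
  by move: i iS; near: n; apply: p_le; rewrite ltrDl.
have hi1 : (v + u) * alpha n <= 1.
  by near: n; apply: cvgr_le (scale_cvg0 _) _ _; exact: ltr01.
have := prob_few_exceedances_bounds (indepY (n := n)) (@pE n) K
  (mulr_ge0 (ltW lo0) (ltW (alpha_gt0 n))) hi1 pS.
set Pn := P _; have Pn_fin : Pn \is a fin_num.
  by apply: fin_num_measure; exact: measurable_few_exceedances.
rewrite -(fineK Pn_fin) !lee_fin => /andP[loP hiP].
have lo_n : poisson_cdf K (c * v) - e <
    \sum_(j < K) 'C(#|S n|, j)%:R * ((v - u) * alpha n) ^+ j *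
      (1 - (v + u) * alpha n) ^+ (#|S n| - j).
  near: n; apply: cvgr_gt _ lo_lt.
  apply: cvg_binomial_sum => //.
  by move=> n; rewrite ltW// mulr_gt0.
have hi_n : \sum_(j < K) 'C(#|S n|, j)%:R * ((v + u) * alpha n) ^+ j *
      (1 - (v - u) * alpha n) ^+ (#|S n| - j) < poisson_cdf K (c * v) + e.
  near: n; apply: cvgr_lt _ hi_lt.
  apply: cvg_binomial_sum => //.
  by move=> n; rewrite ltW// mulr_gt0.
rewrite /= ltr_distlC (lt_le_trans lo_n)//=.
exact: le_lt_trans hiP hi_n.
Unshelve. all: by end_near. Qed.

End PoissonLimit.

Theorem theorem2 (R : realType) :
  exists law : R -> R -> probability (measurableTypeR R) R,
    (forall c g : R, 1 <= c -> 0 < g -> nondegenerate_law (law c g)) /\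
    forall (E : metricType R)
      (F : E -> cumulativeBounded (0 : R) (1 : R))
      (q : R -> E -> R) (gamma : E -> R)
      (d : measure_display) (T : measurableType d) (P : probability T R)
      (x : forall n : nat, 'I_n -> E)
      (Y : forall n : nat, 'I_n -> {RV P >-> R})
      (t : E) (h : nat -> R) (c : R) (alpha : nat -> R),
    let m := fun n => local_count (x n) t (h n) in
    conditional_quantile F q ->
    heavy_tailed q gamma ->
    (forall n, mutually_independent P (fun i : 'I_n => Y n i : T -> R)) ->
    (forall n (i : 'I_n) (y : R), cdf (Y n i) y = (F (x n i) y)%:E) ->
    (forall n, 0 < h n) ->
    h n @[n --> \oo] --> (0 : R) ->
    condition_A q gamma t ->
    1 <= c ->
    (forall n, 0 < alpha n < 1) ->
    alpha n @[n --> \oo] --> (0 : R) ->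
    (m n)%:R * alpha n @[n --> \oo] --> c ->
    ((Num.truncn ((m n)%:R * alpha n))%:R : R) @[n --> \oo]
      --> ((Num.truncn c)%:R : R) ->
    (exists delta : R, 0 < delta /\
      oscillation q t (h n) ((m n)%:R `^ (- (1 + delta))) @[n --> \oo]
        --> 0%E) ->
    cvg_in_distribution P
      (fun n w =>
         qhat1 (x n) (fun i => Y n i w) t (h n) (alpha n) / q (alpha n) t - 1)
      (law c (gamma t)).
Proof.
have trunc_gt0 (c : R) : 1 <= c -> (0 < Num.truncn c)%N by rewrite truncn_gt0.
have law_ex (c g : R) : exists mu : probability (measurableTypeR R) R,
    1 <= c -> 0 < g ->
    forall y, mu `]-oo, y]%classic = (limit_cdf (Num.truncn c) c g y)%:E.
  have [/andP[c1 g0]|ncg] := boolP ((1 <= c) && (0 < g)).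
    have [mu muE] :=
      limit_law_exists (trunc_gt0 _ c1) (lt_le_trans ltr01 c1) g0.
    by exists mu.
  exists (dirac (0 : measurableTypeR R)) => c1 g0.
  by move: ncg; rewrite c1 g0.
pose law c g := sval (cid (law_ex c g)).
have lawE c g : 1 <= c -> 0 < g -> forall y,
    law c g `]-oo, y]%classic = (limit_cdf (Num.truncn c) c g y)%:E.
  exact: svalP (cid (law_ex c g)).
exists law; split=> [c g c1 g0|].
  apply: (@nondegenerate_of_cdf _ _ 0).
  have c0 : 0 < c := lt_le_trans ltr01 c1.
  rewrite lawE// /limit_cdf addr0 ltr01 powR1 mulr1 !lte_fin.
  rewrite poisson_cdf_lt1// andbT.
  by apply: poisson_cdf_gt0; [exact: trunc_gt0|exact: ltW].
move=> E F q gamma d T P x Y t h c alpha m Fq q_heavy indepY cdfY h0 _ _ c1.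
move=> alpha01 alpha0 malpha trunc_cvg [delta [delta0 osc0]].
have c0 : 0 < c := lt_le_trans ltr01 c1.
have [g0 _] := q_heavy t.
pose S n := local_indices (x n) t (h n).
have SE n : #|S n| = m n by exact: card_local_indices.
have moo k : \forall n \near \oo, (k <= #|S n|)%N.
  have := local_count_infty c1 alpha01 alpha0 malpha (k%:R : R).
  by apply: filterS => n; rewrite ler_nat SE.
split=> [n|y _].
  apply: measurable_funB; last exact: measurable_cst.
  apply: measurable_funM; last exact: measurable_cst.
  by apply: measurable_order_stat_local_sample; rewrite addn1.
rewrite lawE//; set K := Num.truncn c.
pose z n := (1 + y) * q (alpha n) t.
pose p n (i : 'I_n) := 1 - F (x n i) (z n).
have pE n (i : 'I_n) : P (Y n i @^-1` `]-oo, z n]) = (1 - p n i)%:E.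
  by rewrite /p opprB addrC subrK -cdfY.
have truncE : \forall n \near \oo, Num.truncn ((m n)%:R * alpha n) = K.
  have /cvgrPdist_lt/(_ _ ltr01) := trunc_cvg; apply: filterS => n.
  rewrite ltr_distlC ltrBlDr !natr1 !ltr_nat !ltnS -eqn_leq => /eqP Kt.
  exact/esym/Kt.
have eventE : \forall n \near \oo,
    P [set w | (#|exceedances (Y n) (S n) (z n) w| < K)%N] =
    P ((fun w => qhat1 (x n) (fun i => Y n i w) t (h n) (alpha n)
          / q (alpha n) t - 1) @^-1` `]-oo, y]).
  near=> n; congr (P _); apply/seteqP.
  have tK : Num.truncn ((m n)%:R * alpha n) = K by near: n.
  have Km : (K <= #|S n|)%N by near: n.
  have [qt _] := Fq t _ (alpha01 n).
  have evE w : (qhat1 (x n) (fun i => Y n i w) t (h n) (alpha n)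
      / q (alpha n) t - 1 <= y) = (#|exceedances (Y n) (S n) (z n) w| < K)%N.
    rewrite lerBlDr ler_pdivrMr// [y + 1]addrC.
    by rewrite (qhat1_le _ _ (esym tK))// -/(m n) -SE trunc_gt0.
  by split => w /=; rewrite in_itv/= evE.
apply: cvg_trans (near_eq_cvg eventE) _.
have [v0|v0] := ltP 0 (1 + y); last first.
  rewrite /limit_cdf ltNge v0/=; apply: cvg_near_cst; near=> n.
  have Km : (K <= #|S n|)%N by near: n.
  have [qt _] := Fq t _ (alpha01 n).
  have p1 i : p n i = 1.
    have Fle0 : F (x n i) (z n) <= 0.
      by apply: (cdf_le0 Fq); rewrite /z mulr_le0_ge0// ltW.
    have Fge0 : 0 <= F (x n i) (z n) by rewrite -lee_fin -cdfY.
    by rewrite /p (@le_anti _ _ (F (x n i) (z n)) 0) ?Fle0 ?subr0.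
  have p11 i : i \in S n -> 1 <= p n i <= 1 by rewrite p1 lexx.
  have /andP[_] := prob_few_exceedances_bounds (indepY n) (@pE n) K ler01
    (lexx 1) p11.
  rewrite big1 => [P0|j _]; first by apply/le_anti; rewrite P0 measure_ge0.
  by rewrite subrr expr0n subn_eq0 leqNgt (leq_trans (ltn_ord j) Km) mulr0.
rewrite /limit_cdf v0.
apply: (@cvg_few_exceedances _ _ _ P Y S z p alpha c _
  indepY pE _ alpha0 _ moo) => //.
- by move=> n; have /andP[] := alpha01 n.
- by under eq_cvg do rewrite SE.
- by rewrite powR_gt0.
- move=> la la0 la_lt.
  have v_lt : 1 + y < la `^ (- gamma t).
    by rewrite -[1 + y](powRVK v0 g0); exact: gt0_gtr_powRN.
  have := tail_prob_ge Fq q_heavy h0 c1 alpha01 alpha0 malpha delta0 osc0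
    la0 v0 v_lt.
  by apply: filterS => n H i; rewrite !inE => /H.
- move=> la la_gt; have la0 : 0 < la := le_lt_trans (powR_ge0 _ _) la_gt.
  have v_gt : la `^ (- gamma t) < 1 + y.
    by rewrite -[1 + y](powRVK v0 g0); apply: gt0_gtr_powRN; rewrite ?powR_gt0.
  have := tail_prob_le Fq q_heavy h0 c1 alpha01 alpha0 malpha delta0 osc0
    la0 v0 v_gt.
  by apply: filterS => n H i; rewrite !inE => /H.
Unshelve. all: by end_near. Qed.
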